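(* Let $k \geq 3$ be an integer. Let $G$ be a connected graph with maximum degree $\Delta(G) \leq k$ such that $G$ is not isomorphic to the complete graph $K_k$. Then $V(G)$ can be partitioned into $k+1$ pairwise disjoint $k$-clique isolating sets of $G$.
   Context: All graphs are simple, finite and undirected. For $D \subseteq V(G)$, the closed neighborhood $N[D]$ is the set consisting of $D$ together with all vertices having a neighbor in $D$. A $k$-clique is a copy of the complete graph $K_k$. A subset $D \subseteq V(G)$ is a $k$-clique isolating set of $G$ if $G - N[D]$ contains no $K_k$ as a subgraph. Partitions are weak, i.e. parts may be empty; equivalently, there is a map $c: V(G) \to \{1,\ldots,k+1\}$ (not required to be surjective) such that each of the $k+1$ color classes $c^{-1}(i)$ is a $k$-clique isolating set of $G$. *)

(* Defs.v *)
From mathcomp Require Import all_boot.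
Set Implicit Arguments.
Unset Strict Implicit.
Unset Printing Implicit Defensive.

Record sgraph := SGraph {
  vertex :> finType;
  edge : rel vertex;
  edge_sym : symmetric edge;
  edge_irrefl : irreflexive edge }.

Lemma complete_sym n : symmetric [rel x y : 'I_n | x != y].
Proof. by move=> x y /=; rewrite eq_sym. Qed.

Lemma complete_irrefl n : irreflexive [rel x y : 'I_n | x != y].
Proof. by move=> x /=; rewrite eqxx. Qed.

Definition complete (n : nat) : sgraph :=
  SGraph (@complete_sym n) (@complete_irrefl n).

Section Graph.
Variable G : sgraph.

Definition degree (x : G) : nat := #|[set y | edge x y]|.

Definition max_degree : nat := \max_(x : G) degree x.

(* The graph with no vertices is not considered connected. *)
Definition connected_graph : Prop :=
  0 < #|G| /\ forall x y : G, connect (@edge G) x y.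

Definition closed_nbhd (D : {set G}) : {set G} :=
  D :|: [set v | [exists u in D, edge v u]].

Section Induced.
Variable A : {set G}.

Definition induced_edge : rel {x : G | x \in A} :=
  [rel x y | edge (val x) (val y)].

Lemma induced_sym : symmetric induced_edge.
Proof. by move=> x y; apply: edge_sym. Qed.

Lemma induced_irrefl : irreflexive induced_edge.
Proof. by move=> x; apply: edge_irrefl. Qed.

Definition induced : sgraph := SGraph induced_sym induced_irrefl.
End Induced.

Definition delete (A : {set G}) : sgraph := induced (~: A).
End Graph.

(* Not necessarily induced: edges are preserved, but need not be reflected. *)
Definition contains_subgraph (G H : sgraph) : Prop :=
  exists2 f : H -> G, injective f & forall x y : H, edge x y -> edge (f x) (f y).

Definition isomorphic (G H : sgraph) : Prop :=
  exists2 f : G -> H, bijective f & forall x y : G, edge (f x) (f y) = edge x y.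

Definition clique_isolating (G : sgraph) (k : nat) (D : {set G}) : Prop :=
  ~ contains_subgraph (delete (closed_nbhd D)) (complete k).

(* The parts may be empty, so finset's [partition], which excludes [set0],
   is not the relevant notion. *)
Definition weak_partition (T : finType) (n : nat) (D : 'I_n -> {set T}) : Prop :=
  (forall i j : 'I_n, i != j -> [disjoint D i & D j]) /\
  \bigcup_(i < n) D i = [set: T].

(* Main.v *)
(** A colour class is k-clique isolating as soon as its colour occurs in the
    closed neighbourhood of every k-clique.  Since the maximum degree is at most
    k, two intersecting k-cliques share at least k-1 vertices.  Take a maximal
    family F of pairwise disjoint k-cliques.  Each K in F has an apex x outside
    K such that K + x lies in the closed neighbourhood of every k-clique meeting
    K, so it is enough to colour V(G) with k+1 colours injectively on each
    K + x.  This is possible greedily: the conflict graph is k-degenerate. *)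
Require Import Defs.
From mathcomp Require Import all_boot.
Set Implicit Arguments.
Unset Strict Implicit.
Unset Printing Implicit Defensive.

(** * Greedy colouring of degenerate graphs *)

Lemma degenerate_coloring (T : finType) (h : rel T) (k : nat) :
    symmetric h -> irreflexive h ->
    (forall W : {set T}, W != set0 ->
       exists2 v, v \in W & #|[set u in W | h u v]| <= k) ->
  exists c : T -> 'I_k.+1, forall u v, h u v -> c u != c v.
Proof.
move=> h_sym h_irr h_deg.
have colW (n : nat) (W : {set T}) : #|W| = n ->
    exists c : T -> 'I_k.+1, {in W &, forall u v, h u v -> c u != c v}.
  elim: n W => [|n IHn] W cardW.
    by exists (fun=> ord0) => u v; rewrite (cards0_eq cardW) inE.
  (* Remove a vertex [v] with at most [k] neighbours in [W] and colour the rest; those neighbours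
     leave one of the [k+1] colours free for [v]. *)
  have [|v vW degv] := h_deg W; first by rewrite -card_gt0 cardW.
  have [|c cP] := IHn (W :\ v).
    by move: cardW; rewrite (cardsD1 v) vW => -[].
  have [i iN] : exists i, i \notin c @: [set u in W | h u v].
    apply/existsP; rewrite -negb_forall; apply/negP => /forallP allc.
    have: #|'I_k.+1| <= #|c @: [set u in W | h u v]|.
      by apply/subset_leq_card/subsetP => j _; apply: allc.
    by rewrite card_ord leqNgt ltnS (leq_trans (leq_imset_card _ _)).
  have new u : u \in W -> h u v -> c u != i.
    move=> uW huv; apply: contraNneq iN => <-.
    by apply: imset_f; rewrite inE uW.
  exists (fun u => if u == v then i else c u) => u w uW wW huw.
  have [uv|uv] := eqVneq u v; have [wv|wv] := eqVneq w v.
  - by move: huw; rewrite uv wv h_irr.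
  - by rewrite eq_sym new // h_sym -uv.
  - by rewrite new // -wv.
  - by apply: cP; rewrite ?inE ?uv ?wv.
have [c cP] := colW _ [set: T] erefl.
by exists c => u v; apply: cP; rewrite inE.
Qed.

(** * Colouring disjoint blocks together with their apices *)

Section ApexColoring.
Variables (T : finType) (F : {set {set T}}) (x : {set T} -> T) (k : nat).
Hypotheses (k_gt1 : 1 < k) (trivF : trivIset F).
Hypothesis cardF : {in F, forall P, #|x P |: P| <= k.+1}.

Let conflict (u v : T) :=
  (u != v) && [exists P in F, (u \in x P |: P) && (v \in x P |: P)].

(** A vertex of a block conflicts inside that block and its apex, and also with every block whose
    apex it is. Either some covered vertex of [W] has no conflict of the second sort, or counting
    shows that each block has at most one vertex in [W] and conflicts are very few. *)
Lemma conflict_degenerate (W : {set T}) : W != set0 ->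
  exists2 v, v \in W & #|[set u in W | conflict u v]| <= k.
Proof.
set W' := W :&: cover F => W_neq0.
have confP u v : conflict u v ->
    exists2 P, P \in F & [/\ u != v, u \in x P |: P & v \in x P |: P].
  by case/andP=> uv /exists_inP[P PF /andP[uP vP]]; exists P.
have [W'0|/set0Pn[v0 v0W']] := eqVneq W' set0.
  have [v vW] := set0Pn _ W_neq0; exists v => //.
  (* No vertex of [W] lies in a block, so two vertices of [W] in the same [x P |: P] both equal
     [x P]. *)
  suff ->: [set u in W | conflict u v] = set0 by rewrite cards0.
  have outF u P : u \in W -> P \in F -> (u \in P) = false.
    move=> uW PF; apply/negP => uP.
    have: u \in W' by rewrite inE uW; apply/bigcupP; exists P.
    by rewrite W'0 inE.
  apply/setP => u; rewrite !inE; apply/andP => -[uW /confP[P PF]].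
  by rewrite !inE !(outF _ P) // !orbF => -[/eqP uv /eqP ux /eqP vx];
    case: uv; rewrite ux.
pose F' := [set P in F | P :&: W != set0].
have W'P v : v \in W' -> [/\ v \in W, pblock F v \in F & v \in pblock F v].
  by rewrite inE => /andP[-> vF]; rewrite pblock_mem ?mem_pblock.
have F'I u P : u \in W -> P \in F -> u \in P -> P \in F'.
  move=> uW PF uP; rewrite inE PF; apply/set0Pn; exists u.
  by rewrite inE uP.
(* The blocks that can add conflicts to [v] beyond its own block; those missing [W] are harmless. *)
pose asked v P := [&& P \in F', P != pblock F v & x P == v].
(* With no such block, all conflicts of [v] in [W] lie in its own block plus apex, which has at most
   [k] elements besides [v]. *)
have [/exists_inP[v vW' Nask]|] :=
    boolP [exists v in W', ~~ [exists P, asked v P]].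
  have [vW PF vP] := W'P v vW'; exists v => //.
  set P := pblock F v in PF vP.
  have: #|(x P |: P) :\ v| <= k.
    by have := cardF PF; rewrite (cardsD1 v) inE vP orbT.
  apply: leq_trans; apply/subset_leq_card/subsetP => u.
  rewrite 2!inE => /andP[uW /confP[Q QF [uv uQ vQ]]].
  have [QP|QP] := eqVneq Q P; first by rewrite QP in uQ; rewrite in_set1 uv.
  case/negP: Nask; apply/existsP; exists Q.
  have vNQ : v \notin Q.
    by apply: contra QP => vQ'; rewrite /P (def_pblock trivF QF vQ').
  move: vQ uQ; rewrite !inE (negPf vNQ) orbF => /eqP vx.
  rewrite -vx (negPf uv) /= => uQ.
  by rewrite /asked QP -vx eqxx andbT andbT; apply: F'I uQ.
(* Now every v in W' is the apex of some block r v meeting W; comparing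
   cardinalities, r is onto F' and every block meets W in at most one vertex. *)
rewrite negb_exists_in => /forall_inP allask.
(* On [W'] the default [set0] is never taken, by [allask]. *)
pose r v := odflt set0 [pick P | asked v P].
have rP v : v \in W' -> asked v (r v).
  move=> /allask; rewrite negbK /r; case: pickP => //= none /existsP[P].
  by rewrite none.
have r_inj : {in W' &, injective r}.
  move=> u v /rP/and3P[_ _ /eqP xu] /rP/and3P[_ _ /eqP xv] ruv.
  by rewrite -xu -xv ruv.
have r_sub : r @: W' \subset F'.
  by apply/subsetP => _ /imsetP[v /rP/and3P[rF' _ _] ->].
have F'_sub : F' \subset pblock F @: W'.
  apply/subsetP => P; rewrite inE => /andP[PF /set0Pn[u]].
  rewrite inE => /andP[uP uW]; apply/imsetP; exists u.
    by rewrite inE uW; apply/bigcupP; exists P.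
  by rewrite (def_pblock trivF PF uP).
have leF'W' : #|F'| <= #|W'|.
  exact: leq_trans (subset_leq_card F'_sub) (leq_imset_card _ _).
have leW'F' : #|W'| <= #|F'|.
  by rewrite -(card_in_imset r_inj) subset_leq_card.
have r_onto : r @: W' = F'.
  by apply/eqP; rewrite eqEcard r_sub card_in_imset.
have pb_inj : {in W' &, injective (pblock F)}.
  apply/imset_injP; rewrite eqn_leq leq_imset_card.
  exact: leq_trans leW'F' (subset_leq_card F'_sub).
have oneW u v P : P \in F -> u \in W -> v \in W -> u \in P -> v \in P -> u = v.
  move=> PF uW vW uP vP; apply: pb_inj.
  - by rewrite inE uW; apply/bigcupP; exists P.
  - by rewrite inE vW; apply/bigcupP; exists P.
  by rewrite (def_pblock trivF PF uP) (def_pblock trivF PF vP).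
have [vW PF vP] := W'P v0 v0W'; exists v0 => //.
have /and3P[rF' _ _] := rP v0 v0W'.
move: (rF'); rewrite inE => /andP[rF /set0Pn[w]]; rewrite inE => /andP[wr wW].
(* Only two conflicts are possible: the apex of the block of [v0], and the single vertex [w] of [W]
   in [r v0], which is the only other block meeting [W] with apex [v0]. *)
suff sub2 : [set u in W | conflict u v0] \subset [set x (pblock F v0); w].
  by apply: leq_trans (subset_leq_card sub2) _; rewrite cards2; case: (_ != _);
    rewrite // ltnW.
apply/subsetP => u; rewrite inE => /andP[uW /confP[Q QF []]].
rewrite !inE => uv uQ vQ.
have [vQ'|vNQ] := boolP (v0 \in Q).
  case/predU1P: uQ => [->|uQ]; first by rewrite (def_pblock trivF QF vQ') eqxx.
  by rewrite (oneW u v0 Q) ?eqxx in uv.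
move: vQ uQ; rewrite (negPf vNQ) orbF => /eqP vx.
rewrite -vx (negPf uv) /= => uQ.
have : Q \in r @: W' by rewrite r_onto; apply: F'I uQ.
case/imsetP=> v vW' Qr; have /and3P[_ _ /eqP] := rP v vW'.
rewrite -Qr -vx => v0v; rewrite -v0v in Qr.
by rewrite (oneW u w (r v0)) ?eqxx ?orbT // -Qr.
Qed.

Lemma apex_coloring :
  exists c : T -> 'I_k.+1, {in F, forall P, {in x P |: P &, injective c}}.
Proof.
have [||c cP] := degenerate_coloring _ _ conflict_degenerate.
- move=> u v; rewrite /conflict eq_sym; congr (_ && _).
  by apply: eq_existsb => P; rewrite [(u \in _) && _]andbC.
- by move=> u; rewrite /conflict eqxx.
exists c => P PF u v uP vP /eqP cuv; apply: contraTeq cuv => uv.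
by apply: cP; rewrite /conflict uv; apply/exists_inP; exists P; rewrite ?uP.
Qed.
End ApexColoring.

(** * Intersecting cliques and apices in graphs of maximum degree at most [k] *)

Section Cliques.
Variables (G : sgraph) (k : nat).
Hypotheses (k_gt2 : 2 < k) (deg_le : max_degree G <= k).

(** Boolean and on vertex sets, rather than an embedding of [complete k], so that families of
    cliques are finite sets. *)
Definition kclique (K : {set G}) : bool :=
  (#|K| == k) && [forall u in K, forall v in K, (u != v) ==> edge u v].

Lemma kclique_card K : kclique K -> #|K| = k.
Proof. by case/andP=> /eqP. Qed.

Lemma kclique_edge K : kclique K -> {in K &, forall u v, u != v -> edge u v}.
Proof.
by case/andP=> _ /forall_inP KP u v uK vK; apply/implyP/(forall_inP (KP u uK)).
Qed.

Lemma kclique_sub_nbhd K v : kclique K -> v \in K ->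
  K \subset v |: [set y | edge v y].
Proof.
move=> Kk vK; apply/subsetP => u uK; rewrite !inE.
by have [//|uv] := eqVneq u v; apply: (kclique_edge Kk); rewrite // eq_sym.
Qed.

Lemma card_nbhd1 (v : G) : #|v |: [set y | edge v y]| <= k.+1.
Proof.
rewrite cardsU1 -add1n leq_add ?leq_b1 //.
by apply: leq_trans deg_le; apply: (leq_bigmax_cond (F := @degree G)).
Qed.

(** Both cliques lie in the closed neighbourhood of [v], so their union has at most [k+1] vertices,
    and [2k - (k+1) = k-1]. *)
Lemma kclique_meet K L v : kclique K -> kclique L -> v \in K -> v \in L ->
  k.-1 <= #|K :&: L|.
Proof.
move=> Kk Lk vK vL.
have: #|K :|: L| <= k.+1.
  apply: leq_trans (card_nbhd1 v); apply: subset_leq_card.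
  by rewrite subUset !kclique_sub_nbhd.
rewrite cardsU (kclique_card Kk) (kclique_card Lk) leq_subLR => le2k.
by rewrite -(leq_add2r k.+1) -addSnnS prednK // (ltn_trans _ k_gt2).
Qed.

Lemma kclique_nbhd (K L : {set G}) v : kclique K -> v \in K -> v \in L ->
  K \subset closed_nbhd L.
Proof.
move=> Kk vK vL; apply/subsetP => u uK; rewrite !inE.
have [->|uv] := eqVneq u v; first by rewrite vL.
by apply/orP; right; apply/exists_inP; exists v; rewrite // (kclique_edge Kk).
Qed.

(** Otherwise [K] is nonempty and closed under adjacency, so by connectedness it is all of [G],
    which is then complete on [k] vertices. *)
Lemma kclique_leaves K : connected_graph G -> ~ isomorphic G (complete k) ->
  kclique K -> exists2 y, y \notin K & y \in closed_nbhd K.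
Proof.
move=> [_ Gconn] GnK Kk.
have [/exists_inP[y yN yK]|] :=
  boolP [exists y in ~: K, y \in closed_nbhd K].
  by exists y; rewrite // -in_setC.
rewrite negb_exists_in => /forall_inP Kcl; case: GnK.
have /card_gt0P[z zK] : 0 < #|K| by rewrite kclique_card ?(ltn_trans _ k_gt2).
have KT y : y \in K.
  have Kclosed : closed (@edge G) [in K].
    apply: intro_closed; first exact/sym_connect_sym/edge_sym.
    move=> u v euv uK; apply: contraT => vNK.
    have /negP[] := Kcl v (etrans (in_setC _ _) vNK).
    by rewrite !inE; apply/orP; right; apply/exists_inP; exists u;
      rewrite // edge_sym.
  by rewrite -(closed_connect Kclosed (Gconn z y)).
have cardG : #|G| = k.
  by rewrite -(kclique_card Kk); apply/esym/eq_card => y; rewrite KT.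
exists (fun y => cast_ord cardG (enum_rank y)).
  exists (fun i => enum_val (cast_ord (esym cardG) i)) => [y|i].
    by rewrite cast_ordK enum_rankK.
  by rewrite enum_valK cast_ordKV.
move=> u v /=; rewrite (inj_eq (@cast_ord_inj _ _ _)) (inj_eq enum_rank_inj).
by have [->|uv] := eqVneq u v; rewrite ?edge_irrefl // (kclique_edge Kk).
Qed.

(** If another clique [M] meets [K], take [y] in [M] outside [K]: any [L] meeting [K] also meets
    [K :&: M], hence dominates [y] through [M]. If none does, then [L] can only be [K], and any
    neighbour of [K] outside it serves. *)
Lemma kclique_apex K : connected_graph G -> ~ isomorphic G (complete k) ->
  kclique K -> exists2 y, y \notin K & forall L, kclique L ->
    K :&: L != set0 -> y |: K \subset closed_nbhd L.
Proof.
move=> Gconn GnK Kk.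
have KL L : kclique L -> K :&: L != set0 -> K \subset closed_nbhd L.
  move=> Lk /set0Pn[v]; rewrite inE => /andP[vK vL].
  exact: kclique_nbhd vK vL.
have [/existsP[M /and3P[Mk MK KM0]]|] :=
    boolP [exists M, [&& kclique M, M != K & K :&: M != set0]].
  have /subsetPn[y yM yK] : ~~ (M \subset K).
    by apply: contra MK => MK; rewrite eqEcard MK !kclique_card /=.
  exists y => // L Lk KL0; rewrite subUset KL // andbT sub1set.
  have [v vK vM] : exists2 v, v \in K & v \in M.
    by case/set0Pn: KM0 => v; rewrite inE => /andP[]; exists v.
  have [w wK wL] : exists2 w, w \in K & w \in L.
    by case/set0Pn: KL0 => w; rewrite inE => /andP[]; exists w.
  (* K :&: M and K :&: L miss at most one vertex of K each, and 2 < k. *)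
  have /set0Pn[z] : (K :&: M) :&: (K :&: L) != set0.
    rewrite -card_gt0.
    have := leq_add (kclique_meet Kk Mk vK vM) (kclique_meet Kk Lk wK wL).
    rewrite -cardsUI => le2; rewrite lt0n; apply: contraTneq le2 => ->.
    rewrite addn0 -ltnNge.
    apply: leq_ltn_trans (_ : k < _).
      rewrite -[leqRHS](kclique_card Kk); apply: subset_leq_card.
      by rewrite subUset !subsetIl.
    by case: (k) k_gt2 => [|[|[|n]]] //= _; rewrite addSnnS addSn ltnS leq_addl.
  case/setIP=> /setIP[_ zM] /setIP[_ zL].
  exact: (subsetP (kclique_nbhd Mk zM zL) y yM).
rewrite negb_exists => /forallP noM.
have [y yK yN] := kclique_leaves Gconn GnK Kk.
exists y => // L Lk KL0; have := noM L; rewrite Lk KL0 andbT negbK => /eqP LK.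
by rewrite subUset KL // LK sub1set yN.
Qed.

Lemma max_disjoint_kcliques : exists F : {set {set G}},
  [/\ trivIset F, {in F, forall K, kclique K} &
      forall L, kclique L -> exists2 K, K \in F & K :&: L != set0].
Proof.
pose p (F : {set {set G}}) := trivIset F && (F \subset [set K | kclique K]).
have p0 : p set0.
  by rewrite /p sub0set andbT; apply/trivIsetP => A B; rewrite inE.
have [F /maxsetP[/andP[trivF /subsetP Fk] Fmax] _] := maxset_exists p0.
exists F; split=> // [K /Fk|L Lk]; first by rewrite inE.
have [/exists_inP[K KF KL]|] := boolP [exists K in F, K :&: L != set0].
  by exists K.
rewrite negb_exists_in => /forall_inP disj.
have disjL K : K \in F -> [disjoint K & L].
  by move=> /disj; rewrite negbK -setI_eq0.
have pLF : p (L |: F).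
  apply/andP; split; last first.
    by rewrite subUset sub1set inE Lk; apply/subsetP.
  apply/trivIsetP => A B /setU1P[->|AF] /setU1P[->|BF]; first by rewrite eqxx.
  - by rewrite disjoint_sym disjL.
  - by rewrite disjL.
  - by move/trivIsetP: trivF; apply.
(* Maximality puts [L] itself in [F], and [L], being nonempty, meets itself. *)
have /setP/(_ L) := Fmax _ pLF (subsetUr _ _); rewrite setU11 => /esym LF.
exists L => //; rewrite setIid -card_gt0 kclique_card //.
exact: ltn_trans k_gt2.
Qed.

(** A copy of [complete k] avoiding the closed neighbourhood of [D] is a clique [L]; a vertex of [D]
    in or adjacent to [L] would put a vertex of [L] in that neighbourhood. *)
Lemma clique_isolating_of_kclique (D : {set G}) :
    (forall L, kclique L -> exists2 v, v \in D & v \in closed_nbhd L) ->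
  clique_isolating k D.
Proof.
move=> hitD [f f_inj f_edge].
have vf_inj : injective (val \o f) := inj_comp val_inj f_inj.
pose L := [set val (f i) | i : 'I_k].
have LN u : u \in L -> u \notin closed_nbhd D.
  by case/imsetP=> i _ ->; have := valP (f i); rewrite inE.
have Lk : kclique L.
  rewrite /kclique card_imset // card_ord eqxx /=.
  apply/forall_inP => _ /imsetP[i _ ->]; apply/forall_inP => _ /imsetP[j _ ->].
  apply/implyP => ij; apply: (f_edge i j).
  by apply: contraNneq ij => ->.
have [v vD] := hitD L Lk; rewrite 2!inE => /orP[vL|/exists_inP[u uL evu]].
  by have := LN v vL; rewrite !inE vD.
have /negP[] := LN u uL; rewrite !inE; apply/orP; right.
by apply/exists_inP; exists v; rewrite // edge_sym.
Qed.
End Cliques.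

(** * From the apex colouring to the partition into colour classes *)

Theorem theorem1p9 (k : nat) (hk : 3 <= k) (G : sgraph)
    (hconn : connected_graph G) (hdeg : max_degree G <= k)
    (hK : ~ isomorphic G (complete k)) :
  exists D : 'I_k.+1 -> {set G},
    weak_partition D /\ forall i : 'I_k.+1, clique_isolating k (D i).
Proof.
have [F [trivF Fk Fmeet]] := max_disjoint_kcliques G hk.
pose good (K : {set G}) (y : G) := (y \notin K) &&
  [forall L, kclique k L ==> (K :&: L != set0) ==>
             (y |: K \subset closed_nbhd L)].
have /card_gt0P[z0 _] := hconn.1.
(* The default [z0] exists because [G] is nonempty; it is never taken when [K] is a [k]-clique. *)
pose x K := odflt z0 [pick y | good K y].
have xP K : kclique k K -> good K (x K).
  move=> Kk; rewrite /x; case: pickP => //= none.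
  have [y yK yP] := kclique_apex hk hdeg hconn hK Kk.
  have := none y; rewrite /good yK => /negP[]; apply/forallP => L.
  by apply/implyP => Lk; apply/implyP; apply: yP.
have cardS K : K \in F -> #|x K |: K| = k.+1.
  move/Fk=> Kk; case/andP: (xP K Kk) => xK _.
  by rewrite cardsU1 xK (kclique_card Kk).
have [|c c_inj] := apex_coloring (ltnW hk) trivF (x := x).
  by move=> K /cardS ->.
exists (fun i => [set v | c v == i]); split=> [|i].
  split=> [i j ij|].
    rewrite -setI_eq0; apply/eqP/setP => v; rewrite !inE.
    by apply/andP => -[/eqP-> /eqP ji]; rewrite ji eqxx in ij.
  by apply/setP => v; rewrite inE; apply/bigcupP; exists (c v); rewrite // inE.
apply: clique_isolating_of_kclique => L Lk.
have [K KF KL0] := Fmeet L Lk.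
(* The apex lies outside [K], so there are exactly [k+1] vertices here, and injectivity makes every
   colour occur among them. *)
have cS : c @: (x K |: K) = [set: 'I_k.+1].
  apply/eqP; rewrite eqEcard subsetT cardsT card_ord.
  by rewrite (card_in_imset (c_inj K KF)) cardS // leqnn.
have: i \in c @: (x K |: K) by rewrite cS inE.
case/imsetP=> v vS ->; exists v; first by rewrite inE.
have /andP[_ /forallP/(_ L)] := xP K (Fk K KF); rewrite Lk KL0 /=.
by move/subsetP; apply.
Qed.
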